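(* Let $\mathcal F\subseteq\mathcal M$ be hereditary saturated formations, let $\pi\subseteq\pi(\mathcal F)$ be a non-empty set of primes, and let $M$ be the canonical local satellite of $\mathcal M$ (so $\mathcal M=LF(M)$). (a) Suppose that $\mathcal N\subseteq\mathcal M=\mathcal G_{\pi'}\mathcal M$ and that $\mathcal F$ satisfies the $\pi$-boundary condition in $\mathcal M$. Then $\mathrm{Int}_{\mathcal F}(G)\le \mathrm{Int}_{\mathcal M}(G)$ for every finite group $G$. (b) If for every $p\in\pi$ every $M(p)$-critical group belongs to $\mathcal F$, then $\mathcal N\subseteq\mathcal M$ and $\mathrm{Int}_{\mathcal F}(G)\le Z_{\pi\mathcal M}(G)$ for every finite group $G$. Likewise, if for every $p\in\pi$ every soluble $M(p)$-critical group belongs to $\mathcal F$, then $\mathcal N\subseteq\mathcal M$ and $\mathrm{Int}_{\mathcal F}(G)\le Z_{\pi\mathcal M}(G)$ for every finite soluble group $G$.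
   Context: All groups are finite. $\mathcal N$ is the class of all nilpotent groups. $\pi'$ is the complement of $\pi$ in the set $\mathbb P$ of all primes; $\mathcal G_{\pi'}$ is the class of all $\pi'$-groups, with $\mathcal G_{\varnothing}$ the class of identity groups. $\pi(\mathcal F)$ is the set of all primes dividing the order of some group in $\mathcal F$. Formations. For a class $\mathcal F$ containing the identity group, $G^{\mathcal F}$ is the intersection of all normal subgroups $N$ of $G$ with $G/N\in\mathcal F$. A formation is a class $\mathcal F$ of groups closed under homomorphic images and such that, if $\mathcal F\neq\varnothing$, $G/G^{\mathcal F}\in\mathcal F$ for every group $G$. It is saturated if $G\in\mathcal F$ whenever $G/\Phi(G)\in\mathcal F$, and hereditary if $H\le G\in\mathcal F$ implies $H\in\mathcal F$. For classes $\mathcal X,\mathcal F$, the product $\mathcal X\mathcal F$ is the class of all groups $G$ with $G^{\mathcal F}\in\mathcal X$. Canonical local satellite. For a function $f$ from primes to formations, $LF(f)$ is the class of all groups $G$ such that $G=1$ or $G/C_G(H/K)\in f(p)$ for every chief factor $H/K$ of $G$ and every prime $p$ dividing $|H/K|$. Every non-empty saturated formation $\mathcal F$ has a unique function $F$ (its canonical local satellite) with $\mathcal F=LF(F)$ such that for every prime $p$: $F(p)\subseteq\mathcal F$, and $G\in F(p)$ whenever $G/O_p(G)\in F(p)$. Boundary condition. For a class $\mathcal Y$, a group is $\mathcal Y$-critical if it is not in $\mathcal Y$ but all its proper subgroups are. A saturated formation $\mathcal F$ with canonical local satellite $F$ satisfies the $\pi$-boundary condition in a class $\mathcal X$ if every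 group $G\in\mathcal X$ that is $F(p)$-critical for at least one $p\in\pi$ belongs to $\mathcal F$. Hypercentre. A chief factor $H/K$ of $G$ is $\mathcal M$-central in $G$ if $(H/K)\rtimes (G/C_G(H/K))\in\mathcal M$. $Z_{\pi\mathcal M}(G)$ is the product of all normal subgroups $N$ of $G$ such that either $N=1$ or every chief factor of $G$ below $N$ of order divisible by at least one prime in $\pi$ is $\mathcal M$-central in $G$. A subgroup $U$ of $G$ is $\mathcal F$-maximal in $G$ if $U\in\mathcal F$ and $U\le V\le G$, $V\in\mathcal F$ imply $U=V$. $\mathrm{Int}_{\mathcal F}(G)$ is the intersection of all $\mathcal F$-maximal subgroups of $G$; similarly for $\mathrm{Int}_{\mathcal M}(G)$. *)

(* Defs.v *)
From mathcomp Require Import all_boot all_fingroup all_solvable.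
From mathcomp Require Import boolp.

Set Implicit Arguments.
Unset Strict Implicit.
Unset Printing Implicit Defensive.

Import GroupScope.

(* Invariance under isomorphism is not part of the type; for formations it
   follows from closure under homomorphic images. *)
Definition group_class := forall gT : finGroupType, {group gT} -> Prop.

Definition subclass (X Y : group_class) : Prop :=
  forall (gT : finGroupType) (G : {group gT}), X gT G -> Y gT G.

Definition eqclass (X Y : group_class) : Prop :=
  forall (gT : finGroupType) (G : {group gT}), X gT G <-> Y gT G.

Definition nilpotent_groups : group_class := fun gT G => nilpotent G.

Definition pi'_groups (pi : nat_pred) : group_class := fun gT G => pi^'.-group G.

Definition in_primes_of (F : group_class) (p : nat) : Prop :=
  prime p /\ exists (gT : finGroupType) (G : {group gT}), F gT G /\ p %| #|G|.

Section Residual.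

Variables (F : group_class) (gT : finGroupType) (G : {group gT}).

Definition residual : {set gT} :=
  \bigcap_(N : {group gT} | (N <| G) && `[< F (G / N)%G >]) N.

Canonical residual_group : {group gT} := Eval hnf in [group of residual].

End Residual.

Definition product_class (X F : group_class) : group_class :=
  fun gT G => X gT (residual F G)%G.

(* The empty class is a formation. *)
Definition formation (F : group_class) : Prop :=
  (forall (gT rT : finGroupType) (G : {group gT}) (phi : {morphism G >-> rT}),
     F gT G -> F rT (phi @* G)%G) /\
  ((exists (gT : finGroupType) (G : {group gT}), F gT G) ->
   forall (gT : finGroupType) (G : {group gT}), F _ (G / residual F G)%G).

Definition saturated (F : group_class) : Prop :=
  forall (gT : finGroupType) (G : {group gT}), F _ (G / 'Phi(G))%G -> F gT G.

Definition hereditary (F : group_class) : Prop :=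
  forall (gT : finGroupType) (G H : {group gT}), H \subset G -> F gT G -> F gT H.

Definition hereditary_saturated_formation (F : group_class) : Prop :=
  [/\ formation F, saturated F & hereditary F].

(* [chief_factor G K H] says that H / K is a chief factor of G, and
   ['C_G(H / K | 'Q)] is its centralizer C_G(H/K). *)
Definition LF (f : nat -> group_class) : group_class := fun gT G =>
  G :=: 1 \/
  forall K H : {group gT}, chief_factor G K H ->
  forall p : nat, prime p -> p %| #|H / K| ->
  f p _ (G / 'C_G(H / K | 'Q))%G.

(* Only the values of f at primes are meaningful. *)
Definition canonical_local_satellite (F : group_class)
    (f : nat -> group_class) : Prop :=
  [/\ forall p, prime p -> formation (f p),
      eqclass F (LF f),
      forall p, prime p -> subclass (f p) F
    & forall p, prime p -> forall (gT : finGroupType) (G : {group gT}),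
        f p _ (G / 'O_p(G))%G -> f p gT G].

Definition class_critical (Y : group_class) : group_class := fun gT G =>
  ~ Y gT G /\ forall H : {group gT}, H \proper G -> Y gT H.

Definition boundary_condition (pi : nat_pred) (F X : group_class) : Prop :=
  exists2 f : nat -> group_class, canonical_local_satellite F f &
  forall (gT : finGroupType) (G : {group gT}), X gT G ->
  (exists2 p, p \in pi & class_critical (f p) G) -> F gT G.

Section ChiefSemidirect.

Variables (gT : finGroupType) (G K H : {group gT}).
Hypothesis chHK : chief_factor G K H.

Lemma chief_factor_acts :
  {acts G / 'C_G(H / K | 'Q), on group H / K | 'Q %% 'C_G(H / K | 'Q)}.
Proof.
have [/maxgroupp/andP[/andP[sKH _] nKG] /andP[sHG nHG]] := andP chHK.
have nKH : H \subset 'N(K) := subset_trans sHG nKG.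
have cS : 'C_G(H / K | 'Q) \subset 'C(H / K | 'Q) by apply: subsetIr.
split.
  by rewrite astabs_mod // quotientS // actsQ.
have cD := subset_trans cS (subsetIl _ _).
rewrite gacentE // subsetI quotientS ?subsetT //=.
by rewrite -astabCin.
Qed.

(* (H/K) ><| (G / C_G(H/K)), for the action induced by conjugation. *)
Definition chief_semidirect : finGroupType := sdprod_by <[chief_factor_acts]>.

End ChiefSemidirect.

Definition central_chief_factor (M : group_class) (gT : finGroupType)
    (G K H : {group gT}) (chHK : chief_factor G K H) : Prop :=
  M _ [set: chief_semidirect chHK]%G.

Definition pi_hypercentral (pi : nat_pred) (M : group_class)
    (gT : finGroupType) (G N : {group gT}) : Prop :=
  N :=: 1 \/
  forall (K H : {group gT}) (chHK : chief_factor G K H), H \subset N ->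
  (exists p, [/\ p \in pi, prime p & p %| #|H / K|]) ->
  central_chief_factor M chHK.

Definition hypercentre (pi : nat_pred) (M : group_class)
    (gT : finGroupType) (G : {group gT}) : {set gT} :=
  \prod_(N : {group gT} | (N <| G) && `[< pi_hypercentral pi M G N >]) N.

Definition class_maximal (F : group_class) (gT : finGroupType)
    (G U : {group gT}) : Prop :=
  [/\ U \subset G, F gT U &
      forall V : {group gT}, U \subset V -> V \subset G -> F gT V -> U :=: V].

Definition Int (F : group_class) (gT : finGroupType) (G : {group gT}) : {set gT} :=
  \bigcap_(U : {group gT} | `[< class_maximal F G U >]) U.

(* Main.v *)
Require Import Defs.
From mathcomp Require Import all_boot all_algebra all_fingroup all_solvable.
From mathcomp Require Import mxrepresentation mxabelem.
From mathcomp Require Import boolp.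

(** Every subgroup of G lying in F is contained in an F-maximal subgroup, which
contains I = Int_F(G); as F is hereditary, E I is in F for each subgroup E of G
in F.  A normal subgroup I with this property is called [absorbed] below, and
the property, unlike the definition of Int_F(G), passes to quotients
([absorbed_quotient]).

Both inclusions come from one contradiction ([satellite_of_critical]).  Let N
be a minimal normal subgroup of G inside an absorbed I, let p divide |N|, and
put C = C_G(N).  If a section Y / C of G were not in M(p), it would contain an
M(p)-critical subgroup B, which by hypothesis lies in F.  A minimal supplement
L of C in the preimage of B meets C inside the Frattini subgroup of L, so L is
in F by saturation.  Hence L I is in F, therefore in M, and it has N as a
normal subgroup.  A group X of M acts on such an N through a group of M(p):
X / C_X(N) is in M(p).  As M(p) is hereditary, B is in M(p), a contradiction.

Two facts on a canonical local satellite f of F are used here.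
- If X is in F and N is a nontrivial normal subgroup of X which either is a
  p-group or has O_p(N) = O_p'(N) = 1, then X / C_X(N) is in f(p)
  ([satellite_cent_pgroup], [satellite_cent_pcore1]).  In both cases the
  f(p)-residual of X centralises the chief factors of X that matter.
- If F is hereditary, so is f(p) ([satellite_hereditary]).  For A in f(p) and
  V the regular module of A over the field with p elements, V A is still in
  f(p), hence in F.  For H in A, the subgroup V H is then in F, and f(p)
  contains V H / C_{VH}(V), of which H is a quotient.

(a) Let U be M-maximal in G and I = Int_F(G); it suffices that U I is in M
([absorbed_extension]).  Proceed by induction on |U I|, so that proper
quotients of U I are in M.  Take a minimal normal N inside I.  If N is a
pi'-group, then U I is in G_pi' M = M.  Otherwise the contradiction above, for
F and its own satellite f, shows that each Y / C in M, where C = C(N), is in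
f(p).  If N is not a p-group, either C is nontrivial and U I is a subdirect
product of two groups of M, or C = 1 and U itself is in F, whence U I is in F.
If N is a p-group, either N is in the Frattini subgroup and saturation
concludes, or N has a complement T.  In the latter case the normal subgroup
C_T(N) is nontrivial, giving a subdirect product again, or trivial, in which
case C = N and U I is itself in f(p), so in F.

(b) Applied to G / K, the contradiction puts G / C_G(H/K) into M(p) for each
chief factor H / K below Int_F(G) of order divisible by a p in pi.  This makes
the semidirect product (H/K) (G / C_G(H/K)) a member of M
([central_of_satellite]).  Finally, if some element x of prime order generated
a group outside M, then <x> would be M(p)-critical, hence in F and in M; so M
contains all groups of prime order, and then all nilpotent groups
([nilpotent_sub_of_critical]).  Letting the critical groups range over a class
S treats the general and the soluble case together. *)

Set Implicit Arguments.
Unset Strict Implicit.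
Unset Printing Implicit Defensive.

Import GroupScope.

(** * Formations *)

Section Formations.

Variable F : group_class.
Hypothesis formF : formation F.

Lemma formation_homg (gT rT : finGroupType) (G : {group gT}) (H : {group rT}) :
  F G -> H \homg G -> F H.
Proof.
move=> FG /homgP[f fG]; have := formF.1 _ _ _ f FG.
by congr (F _); apply: val_inj.
Qed.

Lemma formation_trivial (gT : finGroupType) (G : {group gT}) :
  F G -> forall (rT : finGroupType), F [1 rT]%G.
Proof.
move=> FG rT; apply: (formation_homg FG); apply/homgP.
by exists (triv_morph _ _); apply: morphim_trivm.
Qed.

Lemma formation_quotientS (gT : finGroupType) (G H K : {group gT}) :
    G \subset 'N(H) -> G \subset 'N(K) -> H \subset K ->
  F (G / H)%G -> F (G / K)%G.
Proof.
by move=> nHG nKG sHK FGH; apply: formation_homg FGH (homg_quotientS _ _ _).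
Qed.

Lemma formation_quotient1 (gT : finGroupType) (G : {group gT}) :
  F (G / 1)%G -> F G.
Proof. by move/formation_homg; apply; apply/isog_hom/quotient1_isog. Qed.

Lemma residual_norm (gT : finGroupType) (G : {group gT}) :
  G \subset 'N(residual F G).
Proof.
by apply: norms_bigcap; apply/bigcapsP=> N /andP[/andP[]].
Qed.

Lemma residual_min (gT : finGroupType) (G N : {group gT}) :
  N <| G -> F (G / N)%G -> residual F G \subset N.
Proof.
by move=> nsNG FGN; apply: (bigcap_inf N); rewrite nsNG; apply/asboolP.
Qed.

Lemma residual_normal (gT rT : finGroupType) (G : {group gT}) (H : {group rT}) :
  F H -> residual F G <| G.
Proof.
move=> FH; rewrite /normal residual_norm andbT; apply: residual_min => //.
have:= formation_trivial FH (coset_of G); congr (F _).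
exact/val_inj/esym/trivg_quotient.
Qed.

Lemma formation_residual (gT rT : finGroupType) (G : {group gT}) (H : {group rT}) :
  F H -> F (G / residual F G)%G.
Proof. by move=> FH; apply: formF.2; exists rT, H. Qed.

(** This is how closure under subdirect products enters: the residual lies in
both N and K, so it is trivial. *)
Lemma formation_subdirect (gT : finGroupType) (G N K : {group gT}) :
    N <| G -> K <| G -> N :&: K = 1 -> F (G / N)%G -> F (G / K)%G -> F G.
Proof.
move=> nsNG nsKG tiNK FGN FGK; apply: formation_quotient1.
apply: formation_quotientS (formation_residual G FGN).
- exact: residual_norm.
- by rewrite norm1 subsetT.
- by rewrite /= -tiNK subsetI !residual_min.
Qed.

End Formations.

(** * Coprime action and minimal normal subgroups *)

(** By coprime action the fixed points of A in V / L, here all of V / L, lift to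
fixed points in V. *)
Lemma coprime_stable_cent (gT : finGroupType) (A V L : {group gT}) :
    coprime #|V| #|A| -> solvable V -> L \subset V -> A \subset 'N(L) ->
    V \subset 'N(L) ->
  [~: A, V] \subset L -> A \subset 'C(L) -> A \subset 'C(V).
Proof.
move=> coVA solV sLV nLA nLV sAVL cLA.
have qC: 'C_V(A) / L = V / L.
  rewrite coprime_quotient_cent //; apply/setIidPl.
  by rewrite quotient_cents2 // commGC.
rewrite centsC; apply/setIidPl/eqP; rewrite eqEsubset subsetIl /=.
rewrite -(quotientSGK nLV) ?qC // subsetI sLV centsC //.
Qed.

(** O_p(E) and O_p'(E) are characteristic in E, so they lie in O_p(V) and
O_p'(V), and E is their product. *)
Lemma nilpotent_normal_pcore1 (p : nat) (gT : finGroupType) (V E : {group gT}) :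
  'O_p(V) = 1 -> 'O_p^'(V) = 1 -> E <| V -> nilpotent E -> E :=: 1.
Proof.
move=> Op1 Op'1 nsEV nilE.
have core1 pi: 'O_pi(V) = 1 -> 'O_pi(E) = 1.
  move=> O1; apply/trivgP; rewrite -O1 pcore_max ?pcore_pgroup //.
  exact: gFnormal_trans.
by rewrite -(dprodW (nilpotent_pcoreC p nilE)) !core1 ?mulg1.
Qed.

(** The two alternatives separate abelian from nonabelian minimal normal
subgroups.  The second one replaces the decomposition of a nonabelian V into
simple factors: it says all that is used about it. *)
Lemma minnormal_pgroup_or_pcore1 (p : nat) (gT : finGroupType) (G V : {group gT}) :
    minnormal V G -> prime p -> p %| #|V| ->
  p.-group V \/ 'O_p(V) = 1 /\ 'O_p^'(V) = 1.
Proof.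
move=> minV p_pr pV; have /charsimpleP[ntV simV] := minnormal_charsimple minV.
have [-> | ntO] := eqVneq 'O_p(V) 1; last first.
  by left; rewrite -(simV _ ntO (pcore_char _ _)) pcore_pgroup.
right; split=> //; apply: contraTeq pV => ntO.
rewrite -p'natE // -(simV _ ntO (pcore_char _ _)); exact: pcore_pgroup.
Qed.

Lemma minnormal_pgroup_abelian (p : nat) (gT : finGroupType) (G V : {group gT}) :
  minnormal V G -> p.-group V -> abelian V.
Proof.
move=> minV pV.
have [_ _ /is_abelemP[q _ /and3P[]]] // :=
  minnormal_solvable minV (subxx _) (pgroup_sol pV).
Qed.

Lemma chief_factor_above (gT : finGroupType) (G L V : {group gT}) :
    L <| G -> V <| G -> L \proper V ->
  exists2 H : {group gT}, chief_factor G L H & H \subset V.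
Proof.
move=> nsLG nsVG ltLV; have [nLG [sVG nVG]] := (normal_norm nsLG, andP nsVG).
pose P (H : {group gT}) := (L \proper H) && (G \subset 'N(H)).
have PV : P V by rewrite /P ltLV.
have [H /mingroupP[/andP[ltLH nHG] minH] sHV] := mingroup_exists PV.
exists H => //; rewrite /chief_factor /normal nHG (subset_trans sHV) // !andbT.
apply/maxgroupP; rewrite ltLH nLG; split=> // K /andP[ltKH nKG] sLK.
apply: contraTeq (ltKH) => neKL; rewrite (minH K) ?properxx ?proper_sub //.
by rewrite /P nKG properEneq eq_sym neKL sLK.
Qed.

Lemma normal_subcent (gT : finGroupType) (G V : {group gT}) :
  V <| G -> 'C_G(V) <| G.
Proof.
move=> nsVG; rewrite -[X in _ <| X](setIidPl (normal_norm nsVG)).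
exact: subcent_normal.
Qed.

Lemma chief_cent_normal (gT : finGroupType) (G L H : {group gT}) :
  chief_factor G L H -> 'C_G(H / L | 'Q) <| G.
Proof.
case/andP=> /maxgroupp/andP[_ nLG] /andP[_ nHG].
by rewrite /normal subsetIl normsI ?normG // (subset_trans (actsQ nLG nHG)) ?astab_norm.
Qed.

(** * Canonical local satellites *)

Section Satellite.

Variables (F : group_class) (f : nat -> group_class).
Hypothesis satF : canonical_local_satellite F f.

Let satLF : eqclass F (LF f). Proof. by case: satF. Qed.

Lemma satellite_formation p : prime p -> formation (f p).
Proof. by case: satF => formf _ _ _; apply: formf. Qed.

Lemma satellite_sub p : prime p -> subclass (f p) F.
Proof. by case: satF => _ _ sfF _; apply: sfF. Qed.

Lemma satellite_by_pgroup p (gT : finGroupType) (G P : {group gT}) :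
  prime p -> P <| G -> p.-group P -> f p (G / P)%G -> f p G.
Proof.
case: satF => formf _ _ fullf p_pr nsPG pP fGP; apply: fullf => //.
apply: (formation_quotientS (formf p p_pr)) fGP; rewrite ?normal_norm ?pcore_normal //.
exact: pcore_max.
Qed.

Lemma satellite_chief p (gT : finGroupType) (G L H : {group gT}) :
    F G -> prime p -> chief_factor G L H -> p %| #|H / L| ->
  f p (G / 'C_G(H / L | 'Q))%G.
Proof.
move=> FG p_pr chHL pHL; have [G1 | ] := (satLF G).1 FG; last exact.
have /andP[/maxgroupp/andP[ltLH _] /normal_sub sHG] := chHL.
case/idP: (proper_sub_trans ltLH sHG); rewrite G1.
by rewrite properE sub1G andbF.
Qed.

(** The commutator form avoids quotients: it lets the action of the residual on
several chief factors be combined inside G. *)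
Lemma satellite_residual_chief p (gT : finGroupType) (G L H : {group gT}) :
    F G -> prime p -> chief_factor G L H -> p %| #|H / L| ->
  [~: residual (f p) G, H] \subset L.
Proof.
move=> FG p_pr chHL pHL.
have /andP[/maxgroupp/andP[/andP[sLH _] nLG] nsHG] := chHL.
have fGC := satellite_chief FG p_pr chHL pHL.
have formf := satellite_formation p_pr.
have nLH := subset_trans (normal_sub nsHG) nLG.
have nsRG := residual_normal formf G fGC.
have nLR := subset_trans (normal_sub nsRG) nLG.
rewrite -sub_astabQR //.
have h := residual_min (chief_cent_normal chHL) fGC.
by apply: subset_trans h _; apply: subsetIr.
Qed.

(** Let R be the f(p)-residual of X.  A minimal normal subgroup of X inside
R :&: V has order divisible by p because O_p'(V) = 1, so R centralises it; it
is then abelian, which O_p(V) = O_p'(V) = 1 forbids.  So R and V meet trivially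
and R centralises V. *)
Lemma satellite_cent_pcore1 p (gT : finGroupType) (X V : {group gT}) :
    F X -> prime p -> V <| X -> V :!=: 1 -> 'O_p(V) = 1 -> 'O_p^'(V) = 1 ->
  f p (X / 'C_X(V))%G.
Proof.
move=> FX p_pr nsVX ntV Op1 Op'1; have formf := satellite_formation p_pr.
have chiefV (E : {group gT}) : E <| X -> E \subset V -> E :!=: 1 ->
    exists H : {group gT}, [/\ chief_factor X 1%G H, H \subset E & p %| #|H / 1|].
  move=> nsEX sEV ntE.
  have [|H chH sHE] := chief_factor_above (normal1 X) nsEX; first by rewrite proper1G.
  exists H; split=> //; have /andP[/maxgroupp/andP[ltH _] nsHX] := chH.
  rewrite -(card_isog (quotient1_isog H)); apply: contraTT ltH.
  rewrite -p'natE // proper1G negbK -subG1 => p'H; rewrite -Op'1.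
  by apply: pcore_max => //; apply: normalS (subset_trans sHE sEV) (normal_sub nsVX) nsHX.
have [H [chH _ pH]] := chiefV V nsVX (subxx _) ntV.
have fXC := satellite_chief FX p_pr chH pH.
set R := [group of residual (f p) X].
have nsRX : R <| X := residual_normal formf X fXC.
have tiRV : R :&: V = 1.
  apply/eqP; apply: contraT => ntRV.
  have [|K [chK sKRV pK]] := chiefV [group of R :&: V] _ (subsetIr _ _) ntRV.
    exact: normalI.
  have /andP[/maxgroupp/andP[ltK _] nsKX] := chK.
  have [sKR sKV] : K \subset R /\ K \subset V by apply/andP; rewrite -subsetI.
  have abK : abelian K.
    apply/commG1P/trivgP; apply: subset_trans (commSg _ sKR) _.
    exact: satellite_residual_chief chK pK.
  have nsKV : K <| V := normalS sKV (normal_sub nsVX) nsKX.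
  case/negP: (proper_subn ltK).
  by rewrite (nilpotent_normal_pcore1 Op1 Op'1 nsKV (abelian_nil abK)).
have cRV : R \subset 'C_X(V).
  rewrite subsetI normal_sub //; apply/commG1P/trivgP; rewrite -tiRV.
  rewrite commg_subI // subsetI subxx /=.
    exact: subset_trans (normal_sub nsRX) (normal_norm nsVX).
  exact: subset_trans (normal_sub nsVX) (normal_norm nsRX).
apply: (formation_quotientS formf) cRV (formation_residual formf X fXC).
  exact: normal_norm.
exact/normal_norm/normal_subcent.
Qed.

(** The f(p)-residual R of X centralises every chief factor of X below V, so by
coprime action its Sylow q-subgroups with q <> p centralise V.  Thus R C / C,
with C = C_X(V), is a normal p-subgroup of X / C with quotient in f(p), which
puts X / C itself into f(p). *)
Lemma satellite_cent_pgroup p (gT : finGroupType) (X V : {group gT}) :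
    F X -> prime p -> V <| X -> V :!=: 1 -> p.-group V ->
  f p (X / 'C_X(V))%G.
Proof.
move=> FX p_pr nsVX ntV pV; have formf := satellite_formation p_pr.
have [sVX nVX] := andP nsVX.
have pfactor (L H : {group gT}) : chief_factor X L H -> H \subset V -> p %| #|H / L|.
  move=> /andP[/maxgroupp/andP[/andP[sLH nsHL] nLX] nsHX] sHV.
  have pHL : p.-group (H / L) by rewrite quotient_pgroup ?(pgroupS sHV).
  apply: contraR nsHL; rewrite -p'natE // => p'HL.
  rewrite -quotient_sub1 ?(subset_trans (normal_sub nsHX)) // subG1 trivg_card1.
  exact/eqP/(pnat_1 pHL p'HL).
have [|H chH sHV] := chief_factor_above (normal1 X) nsVX; first by rewrite proper1G.
have fXC := satellite_chief FX p_pr chH (pfactor _ _ chH sHV).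
set R := [group of residual (f p) X].
have nsRX : R <| X := residual_normal formf X fXC.
have [sRX nRX] := andP nsRX.
set C := 'C_X(V)%G; have nsCX : C <| X := normal_subcent nsVX.
have pRC : p.-group (R / C).
  apply/pgroupP => q q_pr qRC; rewrite !inE; apply: contraLR qRC => neqp.
  have [Q sylQ] := Sylow_exists q R.
  have sQX := subset_trans (pHall_sub sylQ) sRX.
  pose P (L : {group gT}) := [&& L <| X, L \subset V & Q \subset 'C(L)].
  have [L /maxgroupP[/and3P[nsLX sLV cQL] maxL]] : {L : {group gT} | [max L | P L]}.
    by apply: ex_maxgroup; exists 1%G; rewrite /P normal1 sub1G cents1.
  have cQV : Q \subset 'C(V).
    have [<- // | ltLV] := eqVproper sLV.
    have [K chK sKV] := chief_factor_above nsLX nsVX ltLV.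
    have /andP[/maxgroupp/andP[ltLK nLX] nsKX] := chK.
    case/negP: (proper_subn ltLK).
    suffices PK : P K by rewrite (maxL K PK (proper_sub ltLK)).
    rewrite /P nsKX sKV; apply: (@coprime_stable_cent _ Q K L) => //.
    - apply: pnat_coprime (pgroupS sKV pV) _.
      by apply: sub_in_pnat (pHall_pgroup sylQ) => r _; rewrite !inE => /eqP->.
    - exact: solvableS sKV (pgroup_sol pV).
    - exact: proper_sub.
    - exact: subset_trans sQX nLX.
    - exact: subset_trans (normal_sub nsKX) nLX.
    apply: subset_trans (commSg _ (pHall_sub sylQ)) _.
    by apply: satellite_residual_chief chK (pfactor _ _ chK sKV).
  have sQC : Q \subset C by rewrite subsetI sQX.
  have sylQC := quotient_pHall (subset_trans sQX (normal_norm nsCX)) sylQ.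
  rewrite -p'natE // -partn_eq1 // -(card_Hall sylQC).
  by have /= -> := quotientS1 sQC; rewrite cards1.
have nsRCX : R <*> C <| X by rewrite normalY.
apply: (@satellite_by_pgroup _ _ _ (R <*> C / C)%G p_pr); first exact: quotient_normal.
  by rewrite /= quotientYidr // (subset_trans sRX) ?normal_norm.
apply: (formation_homg formf (formation_residual formf X fXC)).
rewrite (eq_homgl _ (third_isog (joing_subr _ _) nsCX nsRCX)).
by rewrite homg_quotientS ?joing_subl // normal_norm.
Qed.

End Satellite.

(** The group V A1 is the semidirect product of A with its regular module V over
the field with p elements; C(V) = V because the regular module is faithful. *)
Lemma regular_module_extension p (aT : finGroupType) (A : {group aT}) : prime p ->
  exists (wT : finGroupType) (V A1 : {group wT}) (i : {morphism A >-> wT}),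
  [/\ V ><| A1 = [set: wT], 'injm i, i @* A = A1, p.-group V
    & V :!=: 1 /\ 'C(V) \subset V].
Proof.
move=> p_pr; pose to := mx_repr_groupAction (regular_repr 'F_p A).
exists (sdprod_groupType to), (sdpair1 to @* setT)%G, (sdpair2 to @* A)%G, (sdpair2 to).
have defW := sdprod_sdpair to.
have cardV : #|sdpair1 to @* setT| = (p ^ #|A|)%N.
  rewrite card_injm ?injm_sdpair1 ?subxx // cardsT card_mx mul1n card_Fp //.
have abV : abelian (sdpair1 to @* setT).
  rewrite morphim_abelian //.
  by apply/centsP => u _ v _; apply: GRing.addrC.
split=> //; first exact: injm_sdpair2.
  by rewrite /pgroup cardV pnatX pnat_id.
split.
  by rewrite -cardG_gt1 cardV -(exp1n #|A|) ltn_exp2r ?prime_gt1 ?cardG_gt0.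
have [_ defVA _ _] := sdprodP defW.
rewrite -(setTI 'C(_)) -defVA -group_modl //= mulG_subG subxx /=.
apply/subsetP => x /setIP[/morphimP[a _ Aa ->{x}] cVa].
rewrite (_ : a = 1) ?morph1 ?group1 //.
apply/set1gP; apply: (subsetP (regular_mx_faithful 'F_p A)).
have fix_a : a \in 'C(setT | to).
  by rewrite (astabEsd to (subxx _)) inE Aa inE.
apply/rkerP; split=> //; apply/row_matrixP => j.
by rewrite rowE -mx_repr_actE // row1 [LHS](astab_act fix_a) ?inE.
Qed.

(** For A in f(p), the extension V A by the regular module is in f(p), hence in
F.  Its subgroup V H is then in F, and H is a quotient of V H / C(V) as V is
self-centralising. *)
Lemma satellite_hereditary (F : group_class) f p :
    formation F -> hereditary F -> canonical_local_satellite F f -> prime p ->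
  hereditary (f p).
Proof.
move=> formF herF satF p_pr aT A H sHA fA.
have formf := satellite_formation satF p_pr.
have [wT [V [A1 [i [defW injmi imA pV [ntV cVV]]]]]] :=
  regular_module_extension A p_pr.
have [nsVW sA1W defVA nVA tiVA] := sdprod_context defW.
have isoA : A \isog A1 by rewrite -imA sub_isog.
have FW : F _ [set: wT]%G.
  apply: (satellite_sub satF p_pr); apply: (satellite_by_pgroup satF p_pr nsVW pV).
  apply: (formation_homg formf fA); rewrite -(eq_homgl _ (sdprod_isog defW)).
  by rewrite isog_hom // isog_sym.
pose H1 := (i @* H)%G; have sHA1 : H1 \subset A1 by rewrite -imA morphimS.
have nVH := subset_trans sHA1 nVA; pose X := (V <*> H1)%G.
have nsVX : V <| X by rewrite normalYl.
have fXC : f p _ (X / 'C_X(V))%G.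
  by apply: (satellite_cent_pgroup satF) => //; apply: herF FW; apply: subsetT.
have fXV : f p _ (X / V)%G.
  apply: (formation_quotientS formf) fXC; rewrite ?normal_norm ?normal_subcent //.
  by rewrite subIset ?cVV ?orbT.
apply: (formation_homg formf fXV); rewrite /= quotientYidl //.
rewrite -(eq_homgr _ (quotient_isog nVH _)).
  by rewrite isog_hom // sub_isog.
by apply/trivgP; rewrite -tiVA setIS.
Qed.

(** * Minimal supplements *)

(** A maximal subgroup of L0 not containing L0 :&: C would be a smaller
supplement. *)
Lemma minimal_supplement (gT : finGroupType) (L C : {group gT}) :
  L \subset 'N(C) ->
  exists L0 : {group gT}, [/\ L0 \subset L, L0 / C = L / C & L0 :&: C \subset 'Phi(L0)].
Proof.
move=> nCL; pose P (K : {group gT}) := (K \subset L) && (K / C == L / C).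
have [L0 /mingroupP[/andP[sL0L /eqP eqL0] minL0]] : {K : {group gT} | [min K | P K]}.
  by apply: ex_mingroup; exists L; rewrite /P subxx eqxx.
exists L0; split=> //; apply/bigcapsP=> T /orP[/eqP-> | maxT]; first exact: subsetIl.
have nCL0 := subset_trans sL0L nCL.
have ltTL0 := maxgroupp maxT; have sTL0 := proper_sub ltTL0.
have nsCL0 : L0 :&: C <| L0 by rewrite /normal subsetIl normsI ?normG.
apply: contraTT (ltTL0) => nsCT.
have defL0 : (L0 :&: C) <*> T = L0.
  case/maxgroupP: maxT => _ maxT; apply/eqP; rewrite eqEproper.
  rewrite join_subG subsetIl sTL0 /=; apply: contra nsCT => ltL0.
  by rewrite -(maxT _ ltL0) ?joing_subl ?joing_subr.
rewrite (minL0 T) ?properxx //; rewrite /P (subset_trans sTL0) //=.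
rewrite -eqL0 -[X in _ == X / _]defL0.
rewrite quotientY ?(subset_trans sTL0) ?(subset_trans (subsetIl _ _)) //.
by have /= -> := quotientS1 (subsetIr L0 C); rewrite joing1G.
Qed.

(** Groups of F in a quotient lift to groups of F: saturation applies to a
minimal supplement of the kernel. *)
Lemma saturated_supplement (F : group_class) (gT : finGroupType) (L C : {group gT}) :
    formation F -> saturated F -> L \subset 'N(C) -> F _ (L / C)%G ->
  exists L0 : {group gT}, [/\ L0 \subset L, L0 / C = L / C & F _ L0].
Proof.
move=> formF satF nCL FLC; have [L0 [sL0L eqL0 sPhi]] := minimal_supplement nCL.
exists L0; split=> //; have nCL0 := subset_trans sL0L nCL.
apply/satF/(formation_homg formF FLC); rewrite /= -eqL0.
rewrite -(eq_homgr _ (second_isog nCL0)) homg_quotientS //.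
- by rewrite normsI ?normG.
- exact: gFnorm.
- by rewrite /= setIC.
Qed.

(** * Absorbed normal subgroups *)

(** Int_F(G) has this property by [Int_absorbed].  Its image in a quotient of G
need not be the corresponding intersection, but it still has the property. *)
Definition absorbed (F : group_class) (gT : finGroupType) (G I : {group gT}) :=
  I <| G /\ forall E : {group gT}, E \subset G -> F _ E -> F _ (E <*> I)%G.

(** A subgroup of G / R in F is the image of a subgroup of G in F. *)
Lemma absorbed_quotient (F : group_class) (gT : finGroupType) (G I R : {group gT}) :
    formation F -> saturated F -> R <| G -> absorbed F G I ->
  absorbed F (G / R) (I / R).
Proof.
move=> formF satF nsRG [nsIG FI]; split=> [|E sEG FE]; first exact: quotient_normal.
have [sIG nRG] := (normal_sub nsIG, normal_norm nsRG).
have [L defE sRL sLG] := inv_quotientS nsRG sEG.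
have nRL := subset_trans sLG nRG.
have [|L0 [sL0L eqL0 FL0]] := saturated_supplement formF satF nRL.
  by rewrite (_ : (L / R)%G = E) //; apply: val_inj.
have sL0G := subset_trans sL0L sLG.
apply: (formation_homg formF (FI _ sL0G FL0)).
have -> : (E <*> (I / R))%G = ((L0 <*> I) / R)%G.
  apply: val_inj; rewrite /= quotientY ?(subset_trans sL0G) ?(subset_trans sIG) //.
  by rewrite defE eqL0.
by rewrite quotient_homg // join_subG (subset_trans sL0G) ?(subset_trans sIG).
Qed.

(** The common core of both inclusions.  If Y / C were not in m(p), a minimal
counterexample B among its subgroups would be m(p)-critical, so in F.  Lift it
to L0 in F; then L0 I is in F and so in M, hence acts on N through a group of
m(p) which contains B. *)
Lemma satellite_of_critical (F M S : group_class) m p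
    (gT : finGroupType) (G I N Y : {group gT}) :
    hereditary_saturated_formation F -> formation M -> hereditary M ->
    subclass F M -> canonical_local_satellite M m -> prime p ->
    hereditary S ->
    (forall hT (H : {group hT}), S _ H -> class_critical (m p) H -> F _ H) ->
    absorbed F G I -> N <| G -> N \subset I -> N :!=: 1 ->
    p.-group N \/ 'O_p(N) = 1 /\ 'O_p^'(N) = 1 ->
    Y \subset G -> S _ (Y / 'C_G(N))%G ->
  m p _ (Y / 'C_G(N))%G.
Proof.
move=> [formF satF herF] formM herM sFM satM p_pr herS critF.
move=> [nsIG FI] nsNG sNI ntN coreN sYG SY.
set C := 'C_G(N)%G; have nsCG : C <| G := normal_subcent nsNG.
apply: contrapT => nmY.
pose P (B : {group coset_of C}) := (B \subset Y / C) && `[< ~ m p _ B >].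
have [B /mingroupP[/andP[sBY /asboolP nmB] minB]] : {B : {group _} | [min B | P B]}.
  by apply: ex_mingroup; exists (Y / C)%G; rewrite /P subxx; apply/asboolP.
have FB : F _ B.
  apply: critF; first exact: herS sBY SY.
  split=> // H ltHB; apply: contrapT => nmH; case/negP: (proper_subn ltHB).
  rewrite (minB H _ (proper_sub ltHB)) // /P (subset_trans (proper_sub ltHB)) //.
  exact/asboolP.
have [L defB _ sLG] := inv_quotientS nsCG (subset_trans sBY (quotientS C sYG)).
have nCG := normal_norm nsCG; have nCL := subset_trans sLG nCG.
have [|L0 [sL0L eqL0 FL0]] := saturated_supplement formF satF nCL.
  by rewrite (_ : (L / C)%G = B) //; apply: val_inj.
have sL0G := subset_trans sL0L sLG.
pose X := (L0 <*> I)%G; have sXG : X \subset G by rewrite join_subG sL0G normal_sub.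
have MX : M _ X by apply/sFM/FI.
have nsNX : N <| X by rewrite (normalS _ sXG) // (subset_trans sNI) ?joing_subr.
have mXC : m p _ (X / 'C_X(N))%G.
  case: coreN => [pN | [Op1 Op'1]]; first exact: (satellite_cent_pgroup satM).
  exact: (satellite_cent_pcore1 satM).
have formm := satellite_formation satM p_pr.
apply: nmB; apply: (satellite_hereditary formM herM satM p_pr) (_ : m p _ (X / C)%G).
  by rewrite defB -eqL0 quotientS ?joing_subl.
apply: (formation_quotientS formm) mXC; last exact: setSI.
  exact/normal_norm/normal_subcent.
exact: subset_trans nCG.
Qed.

(** * Intersections of maximal subgroups *)

Section Int.

Variable F : group_class.
Hypothesis formF : formation F.

Lemma class_maximal_exists (gT : finGroupType) (G E : {group gT}) :
    E \subset G -> F E ->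
  exists2 U : {group gT}, class_maximal F G U & E \subset U.
Proof.
move=> sEG FE; pose P (U : {group gT}) := (U \subset G) && `[< F U >].
have PE : P E by rewrite /P sEG; apply/asboolP.
have [U /maxgroupP[/andP[sUG /asboolP FU] maxU] sEU] := maxgroup_exists PE.
exists U => //; split=> // V sUV sVG FV; apply/esym/maxU => //.
by rewrite /P sVG; apply/asboolP.
Qed.

Canonical Int_group (gT : finGroupType) (G : {group gT}) : {group gT} :=
  Eval hnf in [group of Int F G].

Lemma Int_sub_max (gT : finGroupType) (G U : {group gT}) :
  class_maximal F G U -> Int F G \subset U.
Proof. by move=> maxU; apply: bigcap_inf; apply/asboolP. Qed.

Lemma class_maximalJ (gT : finGroupType) (G U : {group gT}) x :
  x \in G -> class_maximal F G U -> class_maximal F G (U :^ x).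
Proof.
have FJ (V : {group gT}) y : F V -> F (V :^ y)%G.
  by move/(formation_homg formF); apply; rewrite isog_hom // isog_sym conj_isog.
move=> Gx [sUG FU maxU]; split=> [||V sUV sVG FV]; [|exact: FJ|].
  by rewrite -(conjGid Gx) conjSg.
rewrite /= (maxU (V :^ x^-1)%G) ?conjsgKV //; last exact: FJ.
  by rewrite -sub_conjg.
by rewrite sub_conjgV conjGid.
Qed.

Lemma Int_normal (gT hT : finGroupType) (G : {group gT}) (H : {group hT}) :
  F H -> Int F G <| G.
Proof.
move=> FH; have F1 := formation_trivial formF FH gT.
have [U maxU _] := class_maximal_exists (sub1G G) F1.
rewrite /normal (subset_trans (Int_sub_max maxU)) /=; last by case: maxU.
apply/subsetP => x Gx; rewrite inE; apply/bigcapsP=> V /asboolP maxV.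
rewrite sub_conjg; apply: Int_sub_max; apply: class_maximalJ maxV.
by rewrite groupV.
Qed.

Lemma Int_absorbed (gT hT : finGroupType) (G : {group gT}) (H : {group hT}) :
  hereditary F -> F H -> absorbed F G [group of Int F G].
Proof.
move=> herF FH; split=> [|E sEG FE]; first exact: Int_normal FH.
have [U maxU sEU] := class_maximal_exists sEG FE.
have [_ FU _] := maxU; apply: herF FU.
by rewrite join_subG sEU Int_sub_max.
Qed.

End Int.

(** * Extending members of M by an absorbed subgroup *)

(** Induction on |G|: every proper quotient of G inherits the hypotheses, so is
in M.  The class M plays the role of S in [satellite_of_critical], with F and
its own satellite in place of M and m. *)
Lemma absorbed_extension (F M : group_class) (pi : nat_pred) f
    (gT : finGroupType) (G I U : {group gT}) :
    hereditary_saturated_formation F -> hereditary_saturated_formation M ->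
    subclass F M -> (forall p, p \in pi -> prime p) ->
    eqclass M (product_class (pi'_groups pi) M) ->
    canonical_local_satellite F f ->
    (forall hT (H : {group hT}), M _ H ->
       (exists2 p, p \in pi & class_critical (f p) H) -> F _ H) ->
    absorbed F G I -> U \subset G -> M _ U -> U <*> I = G -> M _ G.
Proof.
move=> hF hM sFM pi_pr defM satF bdM.
have [[formF saF herF] [formM saM herM]] := (hF, hM).
have [n] := ubnP #|G|; elim: n gT G I U => // n IHn gT G I U leGn absI sUG MU defG.
have [nsIG FI] := absI; have [sIG nIG] := andP nsIG.
have [I1 | ntI] := eqVneq (I : {set gT}) 1.
  by have -> : G = U by apply/val_inj; rewrite /= -defG I1 joingG1.
have [N minN sNI] := minnormal_exists ntI nIG.
have /andP[ntN nNG] := mingroupp minN.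
have nsNG : N <| G by rewrite /normal (subset_trans sNI).
have sNG := normal_sub nsNG.
have MQ (R : {group gT}) : R <| G -> R :!=: 1 -> M _ (G / R)%G.
  move=> nsRG ntR; have nRG := normal_norm nsRG.
  apply: (IHn _ _ (I / R)%G (U / R)%G).
  - by rewrite -ltnS; apply: leq_trans leGn; rewrite ltnS ltn_quotient ?normal_sub.
  - exact: absorbed_quotient.
  - exact: quotientS.
  - apply: (formation_homg formM MU).
    by rewrite quotient_homg // (subset_trans sUG).
  - by rewrite /= -quotientY ?(subset_trans sUG) ?(subset_trans sIG) ?defG.
have MGN := MQ N nsNG ntN.
(* If N is a pi'-group then so is the M-residual of G, which lies in N. *)
have [[p [pi_p pN]] | pi'N] := EM (exists p, p \in pi /\ p %| #|N|); last first.
  apply/defM; apply: pgroupS (residual_min nsNG MGN) _.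
  apply/pgroupP => q _ qN; rewrite inE; apply/negP => pi_q.
  by apply: pi'N; exists q.
have p_pr := pi_pr p pi_p; have formf := satellite_formation satF p_pr.
set C := 'C_G(N)%G; have nsCG : C <| G := normal_subcent nsNG.
have coreN := minnormal_pgroup_or_pcore1 minN p_pr pN.
have fY (Y : {group gT}) : Y \subset G -> M _ (Y / C)%G -> f p _ (Y / C)%G.
  move=> sYG; apply: (satellite_of_critical (S := M) hF formF herF)
    absI nsNG sNI ntN coreN sYG => //.
  by move=> hT H MH critH; apply: bdM => //; exists p.
have [abN | [Op1 Op'1]] := coreN; last first.
  have tiNC : N :&: C = 1.
    rewrite /= setIA (setIidPl sNG).
    apply: (nilpotent_normal_pcore1 Op1 Op'1 (center_normal N)).
    exact/abelian_nil/center_abelian.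
  (* When C = 1, the group U is isomorphic to U / C, so U is in f(p). *)
  have [C1 | ntC] := eqVneq (C : {set gT}) 1; last first.
    exact: (formation_subdirect formM nsNG nsCG tiNC MGN (MQ C nsCG ntC)).
  have fUC : f p _ (U / C)%G.
    apply: fY => //; apply: (formation_homg formM MU).
    by rewrite quotient_homg // (subset_trans sUG) ?normal_norm.
  have FU : F _ U.
    apply: (satellite_sub satF p_pr); apply: (formation_quotient1 formf).
    apply: (formation_quotientS formf) fUC; last by rewrite C1.
      by rewrite (subset_trans sUG) ?normal_norm.
    exact/normal_norm/normal1.
  have -> : G = (U <*> I)%G by apply: val_inj.
  exact/sFM/FI.
have {abN}[pgN abN] := (abN, minnormal_pgroup_abelian minN abN).
have sNC : N \subset C by rewrite subsetI sNG.
have fGC : f p _ (G / C)%G.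
  apply: (fY G (subxx _)).
  by apply: (formation_quotientS formM _ _ sNC MGN); rewrite normal_norm.
have [sNPhi | nsNPhi] := boolP (N \subset 'Phi(G)).
  apply: saM; apply: (formation_quotientS formM _ _ sNPhi MGN); rewrite normal_norm //.
  exact: Phi_normal.
have [T maxT nsNT] : exists2 T : {group gT}, maximal T G & ~~ (N \subset T).
  apply: contrapT => noT; case/negP: nsNPhi; apply/bigcapsP=> T /orP[/eqP-> // | maxT].
  by apply: contrapT => /negP nsNT; apply: noT; exists T.
have sTG := proper_sub (maxgroupp maxT); have nNT := subset_trans sTG nNG.
have defNT : N * T = G.
  rewrite -norm_joinEr //; apply/eqP; rewrite eqEproper join_subG sNG sTG /=.
  apply: contra nsNT => ltNT; have [_ maxT'] := maxgroupP maxT.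
  by rewrite -(maxT' _ ltNT) ?joing_subl ?joing_subr.
have tiNT : N :&: T = 1.
  apply/eqP; apply: contraNT nsNT => ntNT; have [_ minN'] := mingroupP minN.
  rewrite -(minN' _ _ (subsetIl N T)) ?subsetIr // ntNT -defNT mulG_subG.
  rewrite (normsI nNT (normG T)) andbT.
  by apply: subset_trans (cent_sub _); rewrite (subset_trans abN) // centS ?subsetIl.
(* T normalises D, and N centralises it. *)
pose D := (C :&: T)%G; have nsDG : D <| G.
  have nDN : N \subset 'N(D).
    apply: subset_trans (cent_sub _); rewrite centsC /=.
    by rewrite subIset // subsetIr.
  have nDT : T \subset 'N(D).
    by rewrite normsI ?normG ?(subset_trans sTG) ?normal_norm.
  have: N * T \subset 'N(D) := mul_subG nDN nDT.
  by rewrite defNT /normal subIset // normal_sub.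
have [D1 | ntD] := eqVneq (D : {set gT}) 1; last first.
  apply: (formation_subdirect formM nsNG nsDG _ MGN (MQ D nsDG ntD)).
  by apply/trivgP; rewrite -tiNT setIS ?subsetIr.
have defC : C = N.
  have := group_modl T sNC; rewrite defNT (setIidPr (normal_sub nsCG)) setIC.
  by rewrite [C :&: T]D1 mulg1 => defC; apply: val_inj.
apply/sFM/(satellite_sub satF p_pr)/(satellite_by_pgroup satF p_pr nsNG pgN).
by rewrite -defC.
Qed.

(** * Centrality of the chief factors below Int_F(G) *)

(** In the first case W is in m(p), since W / V is and V is a p-group.  In the
second, A induces on V all inner automorphisms of V, so
W / C_W(V) is a quotient of A, as W / V is; since V :&: C_W(V) = 1, the group W
is a subdirect product of two groups of m(p). *)
Lemma split_extension_class (M : group_class) m p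
    (gT : finGroupType) (W V A : {group gT}) :
    formation M -> canonical_local_satellite M m -> prime p ->
    V ><| A = W -> m p _ A ->
    p.-group V \/ [/\ 'O_p(V) = 1, 'O_p^'(V) = 1 & V \subset A * 'C(V)] ->
  M _ W.
Proof.
move=> formM satM p_pr defW mA coreV.
have formm := satellite_formation satM p_pr.
have [nsVW sAW defVA nVA tiVA] := sdprod_context defW.
have mWV : m p _ (W / V)%G.
  apply: (formation_homg formm mA).
  by rewrite -(eq_homgl _ (sdprod_isog defW)) homg_refl.
case: coreV => [pV | [Op1 Op'1 sVAC]].
  exact: (satellite_sub satM p_pr (satellite_by_pgroup satM p_pr nsVW pV mWV)).
set C := 'C_W(V)%G; have nsCW : C <| W := normal_subcent nsVW.
have nCW := normal_norm nsCW.
have tiVC : V :&: C = 1.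
  rewrite /= setIA (setIidPl (normal_sub nsVW)).
  apply: (nilpotent_normal_pcore1 Op1 Op'1 (center_normal V)).
  exact/abelian_nil/center_abelian.
have sWCA : W \subset A * C.
  rewrite /= setIC group_modl // subsetI subxx andbT.
  rewrite -norm_joinEl ?norms_cent // -defVA mulG_subG joing_subl andbT.
  by rewrite /= norm_joinEl ?norms_cent.
apply: (formation_subdirect formM nsVW nsCW tiVC (satellite_sub satM p_pr mWV)).
apply: (formation_homg formM (satellite_sub satM p_pr mA)).
have -> : (W / C = A / C)%G.
  apply: val_inj; apply/eqP => /=.
  by rewrite eqEsubset (quotientS _ sAW) andbT -(quotientMidr C A) quotientS.
by apply: quotient_homg; apply: subset_trans nCW.
Qed.

Lemma central_of_satellite (M : group_class) m p (gT : finGroupType) (G K H : {group gT})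
    (chHK : chief_factor G K H) :
    formation M -> canonical_local_satellite M m -> prime p -> p %| #|H / K| ->
    m p _ (G / 'C_G(H / K | 'Q))%G ->
  central_chief_factor M chHK.
Proof.
move=> formM satM p_pr pHK mGC.
have formm := satellite_formation satM p_pr.
have [nsHG [sKH nKG]] : H <| G /\ K \subset H /\ G \subset 'N(K).
  by have /andP[/maxgroupp/andP[/andP[]]] := chHK.
have [sHG nHG] := andP nsHG.
pose to := <[chief_factor_acts chHK]>%gact.
apply: (split_extension_class formM satM p_pr (sdprod_sdpair to)).
  by apply: (formation_homg formm mGC); apply: morphim_homg.
have inj1 := injm_sdpair1 to.
case: (minnormal_pgroup_or_pcore1 (chief_factor_minnormal chHK) p_pr pHK).
  by move=> pV; left; rewrite morphim_pgroup.
case=> Op1 Op'1; right; split.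
- by rewrite -injm_pcore // Op1 morphim1.
- by rewrite -injm_pcore // Op'1 morphim1.
apply/subsetP => _ /morphimP[v Vv _ ->].
case/morphimP: (Vv) => h nKh Hh defv.
have Gh := subsetP sHG h Hh.
set a := coset 'C_G(H / K | 'Q) h.
have Aa : a \in (G / 'C_G(H / K | 'Q))%G by apply: mem_quotient.
apply/mulsgP; exists (sdpair2 to a) ((sdpair2 to a)^-1 * sdpair1 to v);
  [exact: mem_morphim | | by rewrite mulKVg].
have act_a : {in H / K, forall x,
    sdpair1 to x ^ sdpair2 to a = sdpair1 to x ^ sdpair1 to v}.
  move=> x Vx; rewrite -sdpair_act // -morphJ //; congr (sdpair1 to _).
  have nCh : h \in 'N('C_G(H / K | 'Q)).
    by apply: subsetP Gh; apply/normal_norm/(chief_cent_normal chHK).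
  transitivity ('Q%act x h); last by rewrite qactJ nKh defv.
  rewrite -(@modactE _ _ _ 'Q%act 'C_G(H / K | 'Q)%G x h) //.
  - exact: (actbyE _ Vx Aa).
  - by rewrite /= dom_qactJ.
  by apply/afixP => b /setIP[_ /setIP[_ cVb]]; apply: astab_act cVb Vx.
apply/centP => _ /morphimP[x Vx _ ->]; apply/commute_sym/commgP/conjg_fixP.
(* As a acts on V like v, conjugating x ^ v^-1 by a also gives back x. *)
have Vy : x ^ v^-1 \in H / K by rewrite memJ_norm // groupV (subsetP (normG _)).
rewrite conjgM -{1}(conjgKV v x) morphJ // -act_a // conjgK -morphJ //.
by rewrite conjgKV.
Qed.

(** The hypercentre is a product of sets, each containing 1, so it contains each
of its factors. *)
Lemma mem_hypercentre pi (M : group_class) (gT : finGroupType) (G N : {group gT}) :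
  N <| G -> pi_hypercentral pi M G N -> N \subset hypercentre pi M G.
Proof.
move=> nsNG cN; rewrite /hypercentre.
have: N \in index_enum {group gT} by rewrite mem_index_enum.
elim: (index_enum _) => //= K s IHs; rewrite inE big_cons => /predU1P[<- | /IHs sN].
  rewrite nsNG; case: asboolP => // _; apply: mulg_subl.
  by elim/big_ind: _ => [|A B A1 B1|L _]; rewrite ?group1 // -[1]mulg1 mem_mulg.
by case: ifP => // _; apply: subset_trans sN _; apply: mulg_subr.
Qed.

(** For L maximal among the normal subgroups of G of order prime to p, any chief
factor H / L of G has order divisible by p, so m(p) is not empty. *)
Lemma satellite_trivial (M : group_class) m p (gT : finGroupType) (G : {group gT}) :
    canonical_local_satellite M m -> prime p -> p %| #|G| -> M _ G ->
  forall rT : finGroupType, m p _ [1 rT]%G.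
Proof.
move=> satM p_pr pG MG; pose P (L : {group gT}) := (L <| G) && ~~ (p %| #|L|).
have [L /maxgroupP[/andP[nsLG p'L] maxL]] : {L : {group gT} | [max L | P L]}.
  by apply: ex_maxgroup; exists 1%G; rewrite /P normal1 cards1 Euclid_dvd1.
have ltLG : L \proper G.
  by rewrite properEneq normal_sub // andbT; apply: contraNneq p'L => ->.
have [H chH _] := chief_factor_above nsLG (normal_refl G) ltLG.
have /andP[/maxgroupp/andP[ltLH nLG] nsHG] := chH.
have pH : p %| #|H|.
  apply: contraT => p'H; case/negP: (proper_subn ltLH).
  by rewrite (maxL H _ (proper_sub ltLH)) // /P nsHG.
have pHL : p %| #|H / L|.
  rewrite card_quotient ?(subset_trans (normal_sub nsHG)) //.
  by move: pH; rewrite -(Lagrange (proper_sub ltLH)) Euclid_dvdM // (negPf p'L).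
have formm := satellite_formation satM p_pr.
exact: (formation_trivial formm (satellite_chief satM MG p_pr chH pHL)).
Qed.

Lemma chief_factor_nilpotent (gT : finGroupType) (G L H : {group gT}) :
  nilpotent G -> chief_factor G L H -> 'C_G(H / L | 'Q) = G.
Proof.
move=> nilG chH; have /andP[/maxgroupp/andP[_ nLG] nsHG] := chH.
apply/setIidPl; rewrite sub_astabQ nLG /=.
have /mingroupP[/andP[ntHL _] minHL] := chief_factor_minnormal chH.
have nsHL : H / L <| G / L by apply: quotient_normal.
have ntZ : H / L :&: 'Z(G / L) != 1 by rewrite meet_center_nil ?quotient_nil.
have <- : H / L :&: 'Z(G / L) = H / L.
  apply: (minHL [group of H / L :&: 'Z(G / L)]); rewrite ?subsetIl // ntZ /=.
  by rewrite normsI ?gFnorm // normal_norm.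
by rewrite centsC subIset // subsetIr orbT.
Qed.

(** A chief factor of a nilpotent group is central, so it is enough that m(q)
contains the trivial group for each prime q dividing |G|.  This holds as soon
as M contains a group of order q; one outside M would be m(p)-critical, its
only proper subgroup being trivial. *)
Lemma nilpotent_sub_of_critical (F M S : group_class) m p :
    subclass F M -> canonical_local_satellite M m ->
    prime p -> in_primes_of F p ->
    (forall gT (G : {group gT}), abelian G -> S _ G) ->
    (forall hT (H : {group hT}), S _ H -> class_critical (m p) H -> F _ H) ->
  subclass nilpotent_groups M.
Proof.
move=> sFM satM p_pr [_ [hT [H [FH pH]]]] abS critF gT G nilG.
have m1 := satellite_trivial satM p_pr pH (sFM _ _ FH).
have satLF : eqclass M (LF m) by case: satM.
apply/satLF; right=> L K chK q q_pr qKL.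
have /andP[/maxgroupp/andP[_ nLG] /andP[sKG _]] := chK.
have qG : q %| #|G|.
  apply: dvdn_trans qKL (dvdn_trans (dvdn_quotient _ _) (cardSg sKG)).
have [x Gx ox] := Cauchy q_pr qG.
have Mx : M _ <[x]>%G.
  apply: contrapT => nMx; apply/nMx/sFM/critF; first exact/abS/cycle_abelian.
  split=> [mx | K1 ltK1]; first exact/nMx/(satellite_sub satM p_pr).
  have := m1 gT; congr (m p _ _); apply/esym/val_inj => /=.
  have : #|K1| \in pred2 1%N q.
    by have := cardSg (proper_sub ltK1); rewrite -orderE ox => /(primeP q_pr).2.
  case/pred2P => [/card1_trivg // | K1q].
  by have := proper_card ltK1; rewrite K1q -orderE ox ltnn.
have qx : q %| #|<[x]>| by rewrite -orderE ox.
set C := 'C_G(K / L | 'Q)%G.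
have := satellite_trivial satM q_pr qx Mx (coset_of C); congr (m q _ _).
by apply/esym/val_inj/quotientS1; have /= -> := chief_factor_nilpotent nilG chK.
Qed.

(** Dividing by K turns a chief factor H / K of G into a minimal normal subgroup
of G / K inside an absorbed subgroup.  The class S stands for all groups or for
all soluble groups. *)
Lemma Int_sub_hypercentre (F M S : group_class) m (pi : nat_pred)
    (gT : finGroupType) (G : {group gT}) :
    hereditary_saturated_formation F -> formation M -> hereditary M ->
    subclass F M -> canonical_local_satellite M m ->
    (exists hT (H : {group hT}), F _ H) ->
    hereditary S ->
    (forall aT bT (A : {group aT}) (B : {group bT}), S _ A -> B \homg A -> S _ B) ->
    (forall p, p \in pi -> forall hT (H : {group hT}),
       S _ H -> class_critical (m p) H -> F _ H) ->
    S _ G ->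
  Int F G \subset hypercentre pi M G.
Proof.
move=> hF formM herM sFM satM [hT [E FE]] herS imS critF SG.
have [formF saF herF] := hF.
have absI := Int_absorbed formF G herF FE.
apply: (mem_hypercentre absI.1); right=> K H chHK sHI [p [pi_p p_pr pHK]].
apply: (central_of_satellite _ formM satM p_pr pHK).
have /andP[/maxgroupp/andP[/andP[sKH _] nKG] nsHG] := chHK.
have nsKG : K <| G by rewrite /normal (subset_trans sKH (normal_sub nsHG)).
have minHK := chief_factor_minnormal chHK.
have /andP[ntHK _] := mingroupp minHK.
have mGC : m p _ (G / K / 'C_(G / K)(H / K))%G.
  apply: (satellite_of_critical hF formM herM sFM satM p_pr herS (critF p pi_p)
    (absorbed_quotient formF saF nsKG absI)) => //.
  - exact: quotient_normal.
  - exact: quotientS.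
  - exact: minnormal_pgroup_or_pcore1 minHK p_pr pHK.
  apply: (imS _ _ _ _ (imS _ _ _ _ SG (quotient_homg nKG))).
  by apply: quotient_homg; apply/normal_norm/normal_subcent/quotient_normal.
set C := 'C_G(H / K | 'Q)%G; have nsCG : C <| G := chief_cent_normal chHK.
have sKC : K \subset C.
  rewrite subsetI normal_sub // sub_astabQ normG /=.
  by have /= -> := quotientS1 (subxx K); apply: sub1G.
have defC : 'C_(G / K)(H / K)%G = (C / K)%G.
  by apply: val_inj; rewrite /= quotientGI ?normal_sub // quotient_astabQ.
apply: (formation_homg (satellite_formation satM p_pr) mGC).
rewrite defC -(eq_homgl _ (third_isog sKC nsKG nsCG)); exact: homg_refl.
Qed.

Theorem theoremC (F M : group_class) (pi : nat_pred) (m : nat -> group_class)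
    (hF : hereditary_saturated_formation F)
    (hM : hereditary_saturated_formation M)
    (sFM : subclass F M)
    (pi_neq0 : exists p, p \in pi)
    (pi_sub : forall p, p \in pi -> in_primes_of F p)
    (hm : canonical_local_satellite M m) :
  (subclass nilpotent_groups M ->
   eqclass M (product_class (pi'_groups pi) M) ->
   boundary_condition pi F M ->
   forall (gT : finGroupType) (G : {group gT}), Int F G \subset Int M G)
  /\
  ((forall p, p \in pi ->
      forall (gT : finGroupType) (G : {group gT}), class_critical (m p) G -> F gT G) ->
   subclass nilpotent_groups M /\
   forall (gT : finGroupType) (G : {group gT}),
     Int F G \subset hypercentre pi M G)
  /\
  ((forall p, p \in pi ->
      forall (gT : finGroupType) (G : {group gT}),
        solvable G -> class_critical (m p) G -> F gT G) ->
   subclass nilpotent_groups M /\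
   forall (gT : finGroupType) (G : {group gT}),
     solvable G -> Int F G \subset hypercentre pi M G).
Proof.
have [p0 pi_p0] := pi_neq0.
have p0_pr := (pi_sub p0 pi_p0).1.
have [formF saF herF] := hF; have [formM saM herM] := hM.
have pi_pr p : p \in pi -> prime p by case/pi_sub.
have neF : exists hT (H : {group hT}), F _ H.
  by have [_ [hT [H [FH _]]]] := pi_sub p0 pi_p0; exists hT, H.
split=> [_ defM [f satF bdM] gT G|].
  have [hT [H FH]] := neF; have [nsIG FI] := Int_absorbed formF G herF FH.
  apply/bigcapsP=> U /asboolP[sUG MU maxU].
  pose UI := (U <*> [group of Int F G])%G.
  have sUIG : UI \subset G by rewrite join_subG sUG normal_sub.
  have absUI : absorbed F UI [group of Int F G].
    split=> [|E sE]; last exact/FI/(subset_trans sE).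
    by rewrite (normalS _ sUIG) ?joing_subr.
  have MUI : M _ UI.
    exact: (absorbed_extension hF hM sFM pi_pr defM satF bdM absUI (joing_subl _ _) MU).
  by rewrite (maxU UI) ?joing_subl ?joing_subr.
have part_b (S : group_class) : hereditary S ->
    (forall aT bT (A : {group aT}) (B : {group bT}), S _ A -> B \homg A -> S _ B) ->
    (forall gT (G : {group gT}), abelian G -> S _ G) ->
    (forall p, p \in pi -> forall hT (H : {group hT}),
       S _ H -> class_critical (m p) H -> F _ H) ->
  subclass nilpotent_groups M /\
  forall (gT : finGroupType) (G : {group gT}),
    S _ G -> Int F G \subset hypercentre pi M G.
  move=> herS imS abS critF; split=> [|gT G SG].
    exact: (nilpotent_sub_of_critical sFM hm p0_pr (pi_sub _ pi_p0) abS (critF _ pi_p0)).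
  exact: (Int_sub_hypercentre hF formM herM sFM hm neF herS imS critF SG).
split=> critF.
  have [||||nilM IM] // := part_b (fun _ _ => True).
    by move=> p pi_p hT H _; apply: critF.
  by split=> // gT G; apply: IM.
apply: (part_b (fun gT G => solvable G)) critF => [gT G H|aT bT A B solA|gT G].
- exact: solvableS.
- by case/homgP=> g <-; apply: morphim_sol.
- exact: abelian_sol.
Qed.
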